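(* Let $s_0,s_f,v_0,v_f\in\mathbb{R}$ and $\alpha>0$, and put $D:=v_f+v_0+2(s_0-s_f)$. Consider the problem (Paug) of minimizing $$\int_0^1\Big(\tfrac12 u(t)^2+\alpha|v(t)|\Big)dt$$ subject to $$\dot x_1(t)=x_2(t),\quad \dot x_2(t)=u(t),\quad \dot u(t)=v(t)\ \text{ for a.e. } t\in[0,1],$$ $$x_1(0)=s_0,\quad x_1(1)=s_f,\quad x_2(0)=v_0,\quad x_2(1)=v_f,$$ with $x_1,x_2,u\in W^{1,1}([0,1];\mathbb{R})$ and $v\in L^1([0,1];\mathbb{R})$. The solution to (Paug) is unique and is given as follows. The parameter $t_1$ is the solution on the interval $(0,1/2)$ of the cubic equation $$4t^3-3(2+\bar c)t^2+1=0,\qquad \bar c=\frac{|v_f+v_0+2(s_0-s_f)|}{\alpha},$$ $t_2=1-t_1$, and the remaining parameters are $$\bar\lambda_1=\mathrm{sgn}(D)\,\frac{2\alpha}{t_1^2},\qquad \bar u_1=v_f-v_0-\frac{\bar\lambda_1}{2}(1-2t_1),\qquad \bar u_3=2(v_f-v_0)-\bar u_1.$$ The optimal control variable is $$u(t)=\begin{cases}\bar u_1, & 0\le t<t_1,\\ \bar u_1+\bar\lambda_1(t-t_1), & t_1\le t<t_2,\\ \bar u_3, & t_2\le t\le 1,\end{cases}$$ and the state variables are $$x_1(t)=\begin{cases}\frac12\bar u_1t^2+v_0t+s_0, & 0\le t<t_1,\\[1mm] \frac16\bar\lambda_1(t-t_1)^3+\frac12\bar u_1t^2+v_0t+s_0,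 & t_1\le t<t_2,\\[1mm] \frac16\bar\lambda_1(t_2-t_1)^3+\frac12\bar u_1t_2^2+v_0t_2+s_0+\frac12\bar u_3(t-t_2)^2+\big[\frac12\bar\lambda_1(t_2-t_1)^2+\bar u_1t_2+v_0\big](t-t_2), & t_2\le t\le 1,\end{cases}$$ $$x_2(t)=\begin{cases}\bar u_1t+v_0, & 0\le t<t_1,\\[1mm] \frac12\bar\lambda_1(t-t_1)^2+\bar u_1t+v_0, & t_1\le t<t_2,\\[1mm] \frac12\bar\lambda_1(t_2-t_1)^2+\bar u_1t_2+v_0+\bar u_3(t-t_2), & t_2\le t\le 1.\end{cases}$$ As a result, the optimal total variation is given by $$\mathrm{TV}(u)=\left|v_0-v_f-\mathrm{sgn}(D)\,\frac{4\alpha}{t_1^2}(1-2t_1)\right|.$$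
   Context: For $u:[0,1]\to\mathbb{R}$, the total variation is $\mathrm{TV}(u)=\sup\sum_{i=1}^N|u(\tau_i)-u(\tau_{i-1})|$, the supremum being over all partitions $0=\tau_0<\tau_1<\dots<\tau_N=1$; for absolutely continuous $u$ (i.e. $u\in W^{1,1}([0,1];\mathbb{R})$) it equals $\int_0^1|\dot u(t)|\,dt$. Problem (Paug) is the reformulation, with $v=\dot u$ and $u$ assumed absolutely continuous, of the problem (Ptv) of minimizing $\frac12\int_0^1u(t)^2\,dt+\alpha\,\mathrm{TV}(u)$ for the double integrator $\dot x_1=x_2$, $\dot x_2=u$ with the same boundary conditions on $x_1,x_2$. Here $\mathrm{sgn}$ denotes the sign function.
   Formalization: The printed total variation is false; it is corrected to TV(u)=|sgn(D)(2α/t_1^2)(1-2t_1)|. For D=0 the cubic has no root in (0,1/2), so t_1 is taken as its unique root in (0,1/2], with t_1<1/2 whenever D≠0. *)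

(* Defs.v *)
From HB Require Import structures.
From mathcomp Require Import all_boot all_order all_algebra.
From mathcomp Require Import all_classical all_reals all_analysis.

Set Implicit Arguments.
Unset Strict Implicit.
Unset Printing Implicit Defensive.

Import Order.TTheory GRing.Theory Num.Theory.
Import numFieldNormedType.Exports.

Local Open Scope classical_set_scope.
Local Open Scope ring_scope.

(* Functions on [0,1] are represented by functions R -> R; only their values
   on [0,1] are constrained. *)

(* W^{1,1}([a,b];R), identified as usual with the absolutely continuous
   functions on [a,b] (epsilon-delta definition, over finite families of
   nonoverlapping subintervals). *)
Definition W11 (R : realType) (a b : R) (f : R -> R) : Prop :=
  forall e : R, 0 < e ->
  exists2 d : R, 0 < d &
  forall (n : nat) (l r : 'I_n -> R),
    (forall i, [/\ a <= l i, l i <= r i & r i <= b]) ->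
    trivIset [set: 'I_n] (fun i => `]l i, r i[%classic) ->
    \sum_(i < n) (r i - l i) < d ->
    \sum_(i < n) `|f (r i) - f (l i)| < e.

Definition L1 (R : realType) (a b : R) (f : R -> R) : Prop :=
  (@lebesgue_measure R).-integrable `[a, b] (EFin \o f).

Definition ae_derivative (R : realType) (a b : R) (f g : R -> R) : Prop :=
  {ae @lebesgue_measure R, forall t, `[a, b]%classic t ->
    is_derive t 1 f (g t)}.

Definition feasible (R : realType) (s0 sf v0 vf : R)
    (x1 x2 u v : R -> R) : Prop :=
  [/\ [/\ W11 0 1 x1, W11 0 1 x2, W11 0 1 u & L1 0 1 v],
      [/\ ae_derivative 0 1 x1 x2, ae_derivative 0 1 x2 u
        & ae_derivative 0 1 u v]
    & [/\ x1 0 = s0, x1 1 = sf, x2 0 = v0 & x2 1 = vf]].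

Definition cost (R : realType) (alpha : R) (u v : R -> R) : \bar R :=
  (\int[@lebesgue_measure R]_(t in `[0%R, 1%R])
     (2^-1 * u t ^+ 2 + alpha * `|v t|)%:E)%E.

Definition is_solution (R : realType) (s0 sf v0 vf alpha : R)
    (x1 x2 u v : R -> R) : Prop :=
  feasible s0 sf v0 vf x1 x2 u v /\
  forall y1 y2 w z : R -> R, feasible s0 sf v0 vf y1 y2 w z ->
    (cost alpha u v <= cost alpha w z)%E.

(* The solution is unique: states and control are determined at every point of
   [0,1], whereas v, an element of L^1, is determined almost everywhere. *)
Definition is_unique_solution (R : realType) (s0 sf v0 vf alpha : R)
    (x1 x2 u v : R -> R) : Prop :=
  is_solution s0 sf v0 vf alpha x1 x2 u v /\
  forall y1 y2 w z : R -> R, is_solution s0 sf v0 vf alpha y1 y2 w z ->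
    (forall t, 0 <= t <= 1 -> [/\ y1 t = x1 t, y2 t = x2 t & w t = u t]) /\
    {ae @lebesgue_measure R, forall t, `[0, 1]%classic t -> z t = v t}.

Definition opt_u (R : realType) (t1 t2 lambda1 u1 u3 : R) (t : R) : R :=
  if t < t1 then u1
  else if t < t2 then u1 + lambda1 * (t - t1)
  else u3.

Definition opt_x1 (R : realType) (s0 v0 t1 t2 lambda1 u1 u3 : R) (t : R) : R :=
  if t < t1 then 2^-1 * u1 * t ^+ 2 + v0 * t + s0
  else if t < t2 then
    6^-1 * lambda1 * (t - t1) ^+ 3 + 2^-1 * u1 * t ^+ 2 + v0 * t + s0
  else
    6^-1 * lambda1 * (t2 - t1) ^+ 3 + 2^-1 * u1 * t2 ^+ 2 + v0 * t2 + s0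
    + 2^-1 * u3 * (t - t2) ^+ 2
    + (2^-1 * lambda1 * (t2 - t1) ^+ 2 + u1 * t2 + v0) * (t - t2).

Definition opt_x2 (R : realType) (v0 t1 t2 lambda1 u1 u3 : R) (t : R) : R :=
  if t < t1 then u1 * t + v0
  else if t < t2 then 2^-1 * lambda1 * (t - t1) ^+ 2 + u1 * t + v0
  else 2^-1 * lambda1 * (t2 - t1) ^+ 2 + u1 * t2 + v0 + u3 * (t - t2).

(* Main.v *)
Require Import Defs.
From HB Require Import structures.
From mathcomp Require Import all_boot all_order all_algebra.
From mathcomp Require Import all_classical all_reals all_analysis.
From mathcomp Require Import measurable_realfun ring lra.

Import Order.TTheory GRing.Theory Num.Theory.
Import numFieldNormedType.Exports.

Local Open Scope classical_set_scope.
Local Open Scope ring_scope.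

(* The problem is convex.  Let phi be the function with phi' = u - (p + q t) for
   affine p + q t, phi(0) = phi(1) = 0, |phi| <= alpha and
   phi v = alpha |v|.  For a competitor (w, z) one gets
     w^2/2 + alpha |z| >= u^2/2 + alpha |v| + (w - u)^2/2
                          + u (w - u) + phi (z - v)
   pointwise, and the last two terms integrate to 0: they are the derivative of
   an absolutely continuous function vanishing at 0 and 1.  Hence optimality,
   and uniqueness from the term (w - u)^2/2.
   For the given control such a phi exists: it is a parabola growing from 0 to
   sgn(D) alpha on [0, t1], constant on [t1, t2] where v = lambda1, and a
   parabola decreasing back to 0 on [t2, 1].  The cubic equation is the
   remaining boundary condition x1(1) = sf. *)

Section DoubleIntegrator.
Set Implicit Arguments.
Unset Strict Implicit.
Context {R : realType}.
Implicit Types (a b c d e k t x y : R) (f g h : R -> R).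
Local Notation mu := (@lebesgue_measure R).

(** * Absolutely continuous functions *)

Lemma lipschitz_W11 a b k f : 0 <= k ->
  (forall x y, a <= x <= b -> a <= y <= b -> `|f x - f y| <= k * `|x - y|) ->
  W11 a b f.
Proof.
move=> k0 fk e e0; exists (e / (k + 1)); first by rewrite divr_gt0// ltr_wpDl.
move=> n l r lr _ lrd.
have k1 : 0 < k + 1 by rewrite ltr_wpDl.
apply: (@le_lt_trans _ _ (k * \sum_(i < n) (r i - l i))).
  rewrite mulr_sumr ler_sum// => i _.
  have [al li rb] := lr i.
  rewrite (le_trans (fk _ _ _ _))//; first by rewrite (le_trans al).
    by rewrite al (le_trans li).
  by rewrite ger0_norm ?subr_ge0.
move: lrd; rewrite ltr_pdivlMr// mulrC; apply: le_lt_trans.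
rewrite ler_wpM2r ?lerDl// sumr_ge0// => i _.
by have [_ li _] := lr i; rewrite subr_ge0.
Qed.

Lemma W11S a b c d f : a <= c -> d <= b -> W11 a b f -> W11 c d f.
Proof.
move=> ac db fab e /fab[k k0 H]; exists k => // n l r lr; apply: H => i.
by have [cl li rd] := lr i; split=> //; [exact: le_trans cl|exact: le_trans db].
Qed.

Lemma W11D a b f g : W11 a b f -> W11 a b g -> W11 a b (fun t => f t + g t).
Proof.
move=> fab gab e e0; have e20 : 0 < e / 2 by rewrite divr_gt0.
have [k k0 fk] := fab _ e20; have [m m0 gm] := gab _ e20.
exists (Num.min k m); first by rewrite lt_min k0.
move=> n l r lr tI; rewrite lt_min => /andP[lrk lrm].
have := ltrD (fk n l r lr tI lrk) (gm n l r lr tI lrm).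
rewrite -splitr -big_split/=; apply: le_lt_trans; apply: ler_sum => i _.
by rewrite (le_trans _ (ler_normD _ _))// addrACA opprD.
Qed.

Lemma W11N a b f : W11 a b f -> W11 a b (fun t => - f t).
Proof.
move=> fab e /fab[k k0 H]; exists k => // n l r lr tI lrk.
apply: le_lt_trans (H n l r lr tI lrk); apply: ler_sum => i _.
by rewrite -opprD normrN.
Qed.

Lemma W11B a b f g : W11 a b f -> W11 a b g -> W11 a b (fun t => f t - g t).
Proof. by move=> fab gab; apply: W11D => //; exact: W11N. Qed.

(** This is the definition of absolute continuity restricted to families of a single interval. *)
Lemma W11_uniformly_continuous a b f : W11 a b f ->
  forall e, 0 < e -> exists2 d, 0 < d &
    forall x y, a <= x <= b -> a <= y <= b -> `|x - y| < d -> `|f x - f y| < e.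
Proof.
move=> fab e /fab[d d0 H]; exists d => //.
suff K x y : a <= x <= b -> a <= y <= b -> x <= y ->
    `|x - y| < d -> `|f x - f y| < e.
  move=> x y xab yab; have [xy|/ltW yx] := leP x y; first exact: K.
  by rewrite distrC (distrC (f x)); exact: K.
move=> /andP[ax xb] /andP[ay yb] xy.
rewrite distrC ger0_norm ?subr_ge0// => xyd; rewrite distrC.
have := H 1%N (fun=> x) (fun=> y); rewrite !big_ord1; apply=> //.
by move=> i j _ _ _; rewrite (ord1 i) (ord1 j).
Qed.

Lemma W11_continuous a b f : W11 a b f -> {within `[a, b], continuous f}.
Proof.
move=> fab; apply/subspace_continuousP => x /=; rewrite in_itv/= => xab.
apply/cvgrPdist_lt => e e0; have [d d0 H] := W11_uniformly_continuous fab e0.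
rewrite near_withinE; near=> y => /=; rewrite in_itv/= => yab.
apply: H => //; near: y; exact: cvgr_dist_lt.
Unshelve. all: by end_near. Qed.

Lemma W11_bounded a b f : W11 a b f ->
  exists2 k, 0 < k & forall x, a <= x <= b -> `|f x| <= k.
Proof.
move=> /W11_continuous fc.
have /compact_bounded[k [_ fk]] := continuous_compact fc (@segment_compact _ a b).
exists (`|k| + 1); first by rewrite ltr_wpDl.
move=> x xab; apply: fk; first by rewrite (le_lt_trans (ler_norm _))// ltrDl.
by exists x => //=; rewrite in_itv.
Qed.

Lemma W11M a b f g : W11 a b f -> W11 a b g -> W11 a b (fun t => f t * g t).
Proof.
move=> fab gab; have [p p0 fp] := W11_bounded fab.
have [q q0 gq] := W11_bounded gab.
move=> e e0.
have ep : 0 < e / 2 / p by rewrite !divr_gt0.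
have eq : 0 < e / 2 / q by rewrite !divr_gt0.
have [k k0 fk] := fab _ eq; have [m m0 gm] := gab _ ep.
exists (Num.min k m); first by rewrite lt_min k0.
move=> n l r lr tI; rewrite lt_min => /andP[lrk lrm].
(* Each increment of the product splits into an increment of [f] times a value of [g] and a value of
   [f] times an increment of [g]; the values are bounded by [q] and [p]. *)
apply: (@le_lt_trans _ _ (q * (\sum_(i < n) `|f (r i) - f (l i)|) +
    p * (\sum_(i < n) `|g (r i) - g (l i)|))).
  rewrite !mulr_sumr -big_split/=; apply: ler_sum => i _.
  have [al li rb] := lr i.
  have -> : f (r i) * g (r i) - f (l i) * g (l i) =
    (f (r i) - f (l i)) * g (r i) + f (l i) * (g (r i) - g (l i)) by ring.
  rewrite (le_trans (ler_normD _ _))// !normrM lerD//.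
    by rewrite mulrC ler_wpM2r// gq// (le_trans al).
  by rewrite ler_wpM2r// fp// al (le_trans li).
rewrite [e]splitr ltrD// mulrC -ltr_pdivlMr//; first exact: fk.
exact: gm.
Qed.

(** * Absolutely continuous functions with derivative zero almost everywhere *)

(** The step is applied at the supremum of the points of [[a, b]] satisfying [P]: a point just left
    of it carries [P] either to [b] or strictly beyond the supremum, which is absurd. *)
Lemma interval_induction a b (P : R -> Prop) : a <= b -> P a ->
  (forall x, a <= x <= b -> exists2 d, 0 < d & forall y z, a <= y <= b ->
    a <= z <= b -> x - d < y -> y <= x -> x <= z -> z < x + d -> P y -> P z) ->
  P b.
Proof.
move=> ab Pa step; pose E := [set x | a <= x <= b /\ P x].
have Ea : E a by split; rewrite ?lexx.
have Eb : ubound E b by move=> x [/andP[]].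
have supE : has_sup E by split; [exists a|exists b].
have aE : a <= sup E by apply: ub_le_sup => //; exists b.
have Eleb : sup E <= b by apply: ge_sup => //; exists a.
have aEb : a <= sup E <= b by rewrite aE.
have [d d0 H] := step _ aEb.
have [y [yab Py] dy] := sup_adherent d0 supE.
have yE : y <= sup E by apply: ub_le_sup => //; exists b.
have [bd|Ed] := ltP b (sup E + d).
  by apply: (H y) => //; rewrite ab lexx.
have E2 : sup E + d / 2 <= sup E.
  apply: ub_le_sup; first by exists b.
  have zab : a <= sup E + d / 2 <= b by apply/andP; split; lra.
  by split=> //; apply: (H y) => //; lra.
by exfalso; lra.
Qed.

Lemma is_derive0_small f x e : 0 < e -> is_derive x 1 f 0 ->
  exists2 d, 0 < d & forall y, `|y - x| < d -> `|f y - f x| <= e * `|y - x|.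
Proof.
move=> e0 [/cvg_ex[/= l fl] f0].
have {f0} l0 : l = 0 by rewrite -f0; apply/esym/cvg_lim; first exact: Rhausdorff.
move: fl; rewrite {}l0 => /cvgrPdist_lt/(_ _ e0) /nbhs_ballP[d /= d0 H].
exists d => // y yxd; have [->|yx] := eqVneq y x.
  by rewrite !subrr normr0 mulr0.
have yx0 : y - x != 0 by rewrite subr_eq0.
have := H (y - x); rewrite /ball/= sub0r normrN => /(_ yxd yx0).
rewrite sub0r normrN -[(y - x) *: 1]/((y - x) * 1) mulr1 subrK -[_ *: _]/(_ * _).
by rewrite normrM normfV mulrC ltr_pdivrMr ?normr_gt0// => /ltW.
Qed.

(* Interval induction on the existence of finitely many consecutive intervals
   inside [U] that carry all but [e * (x - a)] of the increment of [f]; [U] is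
   an open set of small measure containing the points where [f' = 0] fails. *)
Lemma W11_derive0_cst a b f : a <= b -> W11 a b f ->
  ae_derivative a b f (fun=> 0) -> f b = f a.
Proof.
move=> ab fab [N [mN muN0 fN]].
have N0 : mu N = 0%E by exact: muN0.
suff fe e : 0 < e -> `|f b - f a| <= e * (b - a) + e.
  apply/eqP; rewrite -subr_eq0 -normr_le0; apply/ler_addgt0Pl => e e0.
  rewrite addr0; have ba : 0 < b - a + 1 by lra.
  have := fe (e / (b - a + 1)) (divr_gt0 e0 ba).
  by rewrite -{2}[e / _]mulr1 -mulrDr divfK// gt_eqF.
move=> e0; have [d d0 fd] := fab _ e0.
have [|U [oU NU UN]] := @lebesgue_regularity_outer R N d mN _ d0.
  by rewrite (@le_lt_trans _ _ 0%E) ?ltry// le_eqVlt; apply/orP; left; exact/eqP.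
have mU : measurable U by exact: open_measurable.
have Ud : (mu U < d%:E)%E.
  rewrite (le_lt_trans _ UN)// -[leRHS]adde0 -N0 -measureU//.
  - by rewrite setDKU.
  - exact: measurableD.
  - by rewrite setDKI.
(* The families are listed from left to right in sequences over [nat], so that a new last interval
   can be appended at index [n]. *)
pose P x := exists n (l r : nat -> R),
  [/\ forall i, (i < n)%N -> [/\ a <= l i, l i <= r i, r i <= x &
        `]l i, r i[ `<=` U],
      forall i j, (i < j)%N -> (j < n)%N -> r i <= l j &
      `|f x - f a| <= e * (x - a) + \sum_(i < n) `|f (r i) - f (l i)| ].
have : P b.
  apply: (interval_induction ab).
    exists 0%N, (fun=> a), (fun=> a); split => //.
    by rewrite !subrr normr0 mulr0 big_ord0 addr0.
  (* At a point of [N] a whole ball lies in [U], and the interval from [y] to [z] joins the family.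
     At any other point the derivative is 0, and the increment is absorbed by the term in [e]. *)
  move=> x xab; have [xN|xN] := pselect (N x).
    have /nbhs_ballP[k /= k0 xU] := open_nbhs_nbhs (conj oU (NU _ xN)).
    exists k => // y z yab zab xky yx xz zxk [n [l [r [lr sep fy]]]].
    exists n.+1, (fun i => if (i < n)%N then l i else y),
      (fun i => if (i < n)%N then r i else z); split.
    - move=> i; rewrite ltnS leq_eqVlt => /predU1P[->|ni].
        rewrite ltnn; split=> //.
        + by case/andP: yab.
        + exact: le_trans xz.
        + move=> t /=; rewrite in_itv/= => /andP[yt tz]; apply: xU.
          by rewrite /ball/= ltr_norml; apply/andP; split; lra.
      rewrite ni; have [? ? ? ?] := lr i ni; split=> //; lra.
    - move=> i j ij; rewrite ltnS leq_eqVlt => /predU1P[jn|jn].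
        by rewrite jn ltnn -jn ij; have [] := lr i; rewrite -?jn.
      by rewrite jn (ltn_trans ij jn); exact: sep.
    - rewrite big_ord_recr/= ltnn.
      under eq_bigr => i _ do rewrite ltn_ord.
      have -> : f z - f a = (f y - f a) + (f z - f y) by ring.
      rewrite (le_trans (ler_normD _ _))// addrA lerD//.
      by rewrite (le_trans fy)// lerD2r ler_wpM2l ?(ltW e0)//; lra.
  have {xN} fx : is_derive x 1 f 0.
    have [//|fx] := pselect (is_derive x 1 f 0).
    exfalso; apply: xN; apply: fN => /= /(_ _) H; apply: fx; apply: H.
    by rewrite in_itv.
  have [k k0 xk] := is_derive0_small e0 fx.
  exists k => // y z yab zab xky yx xz zxk [n [l [r [lr sep fy]]]].
  exists n, l, r; split=> //.
    by move=> i /lr[? ? ? ?]; split=> //; lra.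
  have Dz : `|f z - f x| <= e * (z - x).
    by rewrite -[X in e * X]ger0_norm ?xk ?subr_ge0// ger0_norm; lra.
  have Dy : `|f y - f x| <= e * (x - y).
    rewrite -[X in e * X]ger0_norm ?subr_ge0// [X in e * X]distrC.
    by apply: xk; rewrite distrC ger0_norm; lra.
  have -> : f z - f a = (f z - f x) - (f y - f x) + (f y - f a) by ring.
  rewrite (le_trans (ler_normD _ _))//.
  rewrite (le_trans (lerD (ler_normB _ _) fy))//.
  rewrite addrA lerD2r.
  have -> : e * (z - a) = e * (z - x) + e * (x - y) + e * (y - a) by ring.
  by rewrite lerD2r lerD.
(* The intervals are disjoint and inside [U], so their total length is below [d], and absolute
   continuity bounds the remaining sum by [e]. *)
move=> [n [l [r [lr sep /le_trans]]]]; apply; rewrite lerD2l ltW//.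
have tI : trivIset [set: 'I_n] (fun i => `]l i, r i[%classic).
  apply/trivIsetP => i j _ _.
  wlog: i j / (i < j)%N.
    move=> H; rewrite neq_ltn => /orP[ij|ij].
      by apply: H; rewrite // neq_ltn ij.
    by rewrite setIC; apply: H; rewrite // neq_ltn ij.
  move=> ij _; rewrite -subset0 => t [/=]; rewrite !in_itv/=.
  move=> /andP[_ tr] /andP[lt _]; have := sep _ _ ij (ltn_ord j).
  by move=> H; lra.
apply: (fd n (fun i => l i) (fun i => r i)) => //.
  by move=> i; have [] := lr i (ltn_ord i).
rewrite -lte_fin (le_lt_trans _ Ud)// -sumEFin.
have mI (i : 'I_n) : mu `]l i, r i[ = (r i - l i)%:E.
  have [_ li _ _] := lr i (ltn_ord i).
  rewrite lebesgue_measure_itv/= lte_fin; case: ltP => // ri.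
  by congr (_%:E); apply/esym/eqP; rewrite subr_eq0 eq_le ri.
under eq_bigr do rewrite -mI.
rewrite -measure_bigsetU_ord//; apply: le_measure; rewrite ?inE//.
  exact: bigsetU_measurable.
apply: (big_ind (fun A => A `<=` U)) => [||i _]; first exact: sub0set.
  by move=> A B AU BU t [/AU|/BU].
by have [] := lr i (ltn_ord i).
Qed.

(** * Almost everywhere statements, integrable functions and indefinite integrals *)

Lemma lebesgue_aeS (P Q : set R) : (forall t, P t -> Q t) ->
  {ae mu, forall t, P t} -> {ae mu, forall t, Q t}.
Proof. by move=> PQ; apply: filterS PQ; exact: (ae_filter_ringOfSetsType mu). Qed.

Lemma lebesgue_aeS2 (P Q S : set R) : (forall t, P t -> Q t -> S t) ->
  {ae mu, forall t, P t} -> {ae mu, forall t, Q t} -> {ae mu, forall t, S t}.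
Proof. by move=> PQ; apply: filterS2 PQ; exact: (ae_filter_ringOfSetsType mu). Qed.

Lemma sum_Rintegral_le a b f n (l r : 'I_n -> R) : L1 a b f ->
  (forall x, 0 <= f x) -> (forall i, [/\ a <= l i, l i <= r i & r i <= b]) ->
  trivIset [set: 'I_n] (fun i => `]l i, r i[%classic) ->
  \sum_(i < n) \int[mu]_(x in `]l i, r i[) f x <= \int[mu]_(x in `[a, b]) f x.
Proof.
move=> fab f0 lr tI; rewrite -lee_fin -sumEFin.
have sub i : `]l i, r i[ `<=` `[a, b].
  have [al _ rb] := lr i.
  by apply: subset_itv; rewrite bnd_simp.
have fI A : measurable A -> A `<=` `[a, b] ->
    (\int[mu]_(x in A) f x)%:E = (\int[mu]_(x in A) (f x)%:E)%E.
  move=> mA Aab; rewrite fineK//; apply: integrable_fin_num => //.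
  exact: integrableS fab.
under eq_bigr => i _ do rewrite fI//.
rewrite fI// -ge0_integral_bigsetU//.
- have U : \big[setU/set0]_(i < n) `]l i, r i[%classic `<=` `[a, b].
    by apply: (big_ind (fun A => A `<=` `[a, b])) => // A B AU BU t [/AU|/BU].
  apply: ge0_subset_integral => //.
  + exact: bigsetU_measurable.
  + by case/integrableP : fab.
  + by move=> x _; rewrite lee_fin.
- exact: index_enum_uniq.
- exact: sub_trivIset tI.
- apply: (@measurable_funS _ _ _ _ `[a, b]) => //; last by case/integrableP : fab.
  by apply: (big_ind (fun A => A `<=` `[a, b])) => // A B AU BU t [/AU|/BU].
- by move=> x _; rewrite lee_fin.
Qed.

Lemma L1_norm a b f : L1 a b f -> L1 a b (fun t => `|f t|).
Proof. exact: integrable_norm. Qed.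

Lemma L1D a b f g : L1 a b f -> L1 a b g -> L1 a b (fun t => f t + g t).
Proof. exact: integrableD. Qed.

Lemma L1B a b f g : L1 a b f -> L1 a b g -> L1 a b (fun t => f t - g t).
Proof. exact: integrableB. Qed.

Lemma continuous_L1 a b f : {within `[a, b], continuous f} -> L1 a b f.
Proof. by apply: continuous_compact_integrable; exact: segment_compact. Qed.

Lemma L1Z a b k f : L1 a b f -> L1 a b (fun t => k * f t).
Proof. exact: integrableZl. Qed.

Lemma Rintegral_L1D a b f g : L1 a b f -> L1 a b g ->
  \int[mu]_(t in `[a, b]) (f t + g t) =
  \int[mu]_(t in `[a, b]) f t + \int[mu]_(t in `[a, b]) g t.
Proof. exact: RintegralD. Qed.

Lemma le_Rintegral_L1 a b f g : L1 a b f -> L1 a b g ->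
  (forall t, a <= t <= b -> f t <= g t) ->
  \int[mu]_(t in `[a, b]) f t <= \int[mu]_(t in `[a, b]) g t.
Proof.
move=> fab gab fg; apply: le_Rintegral => // t /=; rewrite in_itv/=; exact: fg.
Qed.

Lemma Rintegral_le0_ae a b f : L1 a b f -> (forall t, 0 <= f t) ->
  \int[mu]_(t in `[a, b]) f t <= 0 ->
  {ae mu, forall t, `[a, b]%classic t -> f t = 0}.
Proof.
move=> fab f0 le0.
have mf : measurable_fun (`[a, b] : set (measurableTypeR R)) (EFin \o f).
  by case/integrableP : fab.
have : ae_eq mu `[a, b]%classic (EFin \o f) (cst 0%E).
  apply: (ae_eq_integral_abs mu (measurable_itv _) mf).1.
  under eq_integral do rewrite gee0_abs ?lee_fin//.
  rewrite -[LHS]fineK; last exact: integrable_fin_num.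
  congr (_%:E); apply/eqP; rewrite eq_le le0 fine_ge0// integral_ge0// => t _.
  by rewrite lee_fin.
by apply: lebesgue_aeS => t /= H /H[].
Qed.

Lemma L1M a b f g : W11 a b f -> L1 a b g -> L1 a b (fun t => f t * g t).
Proof.
move=> fab gab; have [k k0 fk] := W11_bounded fab.
have := @integrableMr _ _ _ mu `[a, b] (measurable_itv _) f _ _ _ gab.
apply.
  by apply: subspace_continuous_measurable_fun => //; exact: W11_continuous.
exists k; split; first exact: num_real.
move=> x kx t /=; rewrite in_itv/= => tab.
by rewrite (le_trans (fk _ tab))// ltW.
Qed.

(** Take a continuous [h] within [e / 2] of [g] in L^1, bounded by [q] on [[a, b]]. The increment
    over an interval is at most the integral of [|g - h|] plus [q] times the length; the first terms
    sum to less than [e / 2] by disjointness, the second ones once the total length is below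
    [e / 2 / q]. *)
Lemma Rintegral_W11 a b g : L1 a b g ->
  W11 a b (fun t => \int[mu]_(x in `[a, t]) g x).
Proof.
move=> gab e e0; have e20 : 0 < e / 2 by rewrite divr_gt0.
have [h_ [hc hI hg]] := approximation_continuous_integrable
  (measurable_itv `[a, b]) (compact_finite_measure (@segment_compact _ a b)) gab.
have [h [{}hc hab {}hg]] : exists h, [/\ continuous h, L1 a b h &
    \int[mu]_(x in `[a, b]) `|g x - h x| < e / 2].
  move/fine_cvgP : hg => [_ /cvgrPdist_lt/(_ _ e20)[m _ /(_ m)/= H]].
  exists (h_ m); split=> //; first exact: hI.
  by have := H (leqnn m); rewrite sub0r normrN => /(le_lt_trans (ler_norm _)).
have ghab : L1 a b (fun t => `|g t - h t|) by apply: L1_norm; exact: L1B.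
have /compact_bounded[k [_ hk]] :=
  continuous_compact (continuous_subspaceT hc) (@segment_compact _ a b).
pose q := `|k| + 1; have q0 : 0 < q by rewrite ltr_wpDl.
have {}hk x : `[a, b]%classic x -> `|h x| <= q.
  by move=> xab; apply: hk; [rewrite (le_lt_trans (ler_norm _))// ltrDl|exists x].
exists (e / 2 / q); first by rewrite divr_gt0.
move=> n l r lr tI lrk.
apply: (@le_lt_trans _ _ (\sum_(i < n) (\int[mu]_(x in `]l i, r i[) `|g x - h x|
    + q * (r i - l i)))); last first.
  rewrite big_split/= [e]splitr ltrD//.
    by apply: le_lt_trans hg; exact: sum_Rintegral_le.
  by rewrite -mulr_sumr mulrC -ltr_pdivlMr.
apply: ler_sum => i _; have [al li rb] := lr i.
have sub : `]l i, r i[ `<=` `[a, b] by apply: subset_itv; rewrite bnd_simp.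
rewrite Rintegral_itvB; last 3 first.
- by apply: integrableS gab => //; apply: subset_itv; rewrite bnd_simp.
- by rewrite bnd_simp.
- by rewrite bnd_simp.
have gI A : measurable A -> A `<=` `[a, b] -> mu.-integrable A (EFin \o g).
  by move=> mA Aab; exact: integrableS gab.
rewrite -Rintegral_itv_bndo_bndc; last exact: gI.
rewrite (le_trans (le_normr_Rintegral _ _))//; first exact: gI.
have muI : mu `]l i, r i[ = (r i - l i)%:E.
  rewrite lebesgue_measure_itv/= lte_fin; case: ltP => // ri.
  by congr (_%:E); apply/esym/eqP; rewrite subr_eq0 eq_le ri.
have -> : r i - l i = fine (mu `]l i, r i[) by rewrite muI.
have qab : L1 a b (cst q).
  apply: continuous_L1; apply: continuous_subspaceT => ?.
  exact: cst_continuous.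
rewrite -Rintegral_cst// -RintegralD//;
  [|exact: integrableS ghab|exact: integrableS qab].
apply: le_Rintegral => //.
- by apply: integrableS (L1_norm gab).
- by apply: integrableS (L1D ghab qab).
- move=> x /sub xab; rewrite -[X in `|X|](subrK (h x)).
  by rewrite (le_trans (ler_normD _ _))// lerD2l hk.
Qed.

(** * Derivatives almost everywhere and the fundamental theorem of calculus *)

Lemma ae_notin (s : seq R) : {ae mu, forall t, t \notin s}.
Proof.
exists [set` s]; split.
- apply: countable_measurable => //; apply: finite_set_countable.
  exact: finite_seq.
- apply: countable_lebesgue_measure0; apply: finite_set_countable.
  exact: finite_seq.
- by move=> t /= /negP; rewrite negbK.
Qed.

Lemma ae_derivativeP a b f g (s : seq R) :
  (forall t, `]a, b[%classic t -> t \notin s -> is_derive t 1 f (g t)) ->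
  ae_derivative a b f g.
Proof.
move=> fg; apply: lebesgue_aeS (ae_notin (a :: b :: s)) => t.
rewrite !inE !negb_or => /and3P[ta tb ts] /=.
rewrite in_itv/= => /andP[at_ tb_]; apply: fg => //=.
by rewrite in_itv/= !lt_neqAle at_ tb_ tb eq_sym ta.
Qed.

Lemma eq_ae_derivative a b f g h : (forall t, a <= t <= b -> g t = h t) ->
  ae_derivative a b f g -> ae_derivative a b f h.
Proof.
move=> gh fg; apply: lebesgue_aeS fg => t H /[dup] tab /H.
by rewrite gh//; move: tab; rewrite /= in_itv.
Qed.

Lemma ae_derivativeS a b c d f g : a <= c -> d <= b ->
  ae_derivative a b f g -> ae_derivative c d f g.
Proof.
move=> ac db; apply: lebesgue_aeS => t H /= tcd; apply: H => /=.
move: tcd; rewrite !in_itv/= => /andP[ct td].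
by rewrite (le_trans ac)// (le_trans td).
Qed.

Lemma ae_derivativeD a b f g f' g' : ae_derivative a b f f' ->
  ae_derivative a b g g' ->
  ae_derivative a b (fun t => f t + g t) (fun t => f' t + g' t).
Proof.
apply: lebesgue_aeS2 => t ff gg tab.
by have := is_deriveD (ff tab) (gg tab).
Qed.

Lemma ae_derivativeB a b f g f' g' : ae_derivative a b f f' ->
  ae_derivative a b g g' ->
  ae_derivative a b (fun t => f t - g t) (fun t => f' t - g' t).
Proof.
apply: lebesgue_aeS2 => t ff gg tab.
by have := is_deriveB (ff tab) (gg tab).
Qed.

Lemma ae_derivativeM a b f g f' g' : ae_derivative a b f f' ->
  ae_derivative a b g g' ->
  ae_derivative a b (fun t => f t * g t) (fun t => f t * g' t + g t * f' t).
Proof.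
apply: lebesgue_aeS2 => t ff gg tab.
by have := is_deriveM (ff tab) (gg tab).
Qed.

Lemma Rintegral_ae_derivative a b g : L1 a b g ->
  ae_derivative a b (fun t => \int[mu]_(x in `[a, t]) g x) g.
Proof.
(* [FTC1] asks for integrability beyond [[a, b]], hence the extension [G] of [g] by zero. Near an
   interior point both have the same indefinite integral. *)
move=> gab; pose G := g \_ `[a, b].
have GI A : measurable A -> mu.-integrable A (EFin \o G).
  move=> mA; apply: integrableS (_ : mu.-integrable [set: R] _) => //.
  by rewrite -restrict_EFin -integrable_mkcond.
have GF := @FTC1 _ G (BLeft a) (fun y => GI _ (measurable_itv _))
  (integrable_locally (measurable_itv _) gab).
apply: (lebesgue_aeS2 _ (ae_notin [:: a; b]) GF) => t.
rewrite !inE negb_or => /andP[ta tb] /= H; rewrite in_itv/= => /andP[at_ tb_].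
have {ta}at_ : a < t by rewrite lt_neqAle eq_sym ta.
have {tb_}tb : t < b by rewrite lt_neqAle tb.
have [|dF Fe] := H; first by rewrite lte_fin.
have tab : t \in `[a, b]%classic by rewrite inE/= in_itv/= !ltW.
have -> : g t = G t by rewrite /G patchE tab.
apply: (@near_eq_is_derive _ _ _ (fun t => \int[mu]_(x in `[a, t]) G x)).
  near=> y; apply: eq_Rintegral => x; rewrite inE/= in_itv/= => /andP[ax xy].
  rewrite /G patchE mem_set//= in_itv/= ax (le_trans xy)// ltW//; near: y.
  exact: lt_nbhsl.
exact: DeriveDef dF (etrans (esym (derive1E _ _)) Fe).
Unshelve. all: by end_near. Qed.

(** The difference of [f] and the indefinite integral of [g] is absolutely continuous with
    derivative 0 almost everywhere, hence takes equal values at [a] and [b]. *)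
Lemma W11_FTC a b f g : a <= b -> W11 a b f -> ae_derivative a b f g ->
  L1 a b g -> \int[mu]_(x in `[a, b]) g x = f b - f a.
Proof.
move=> ab fab fg gab; pose h t := f t - \int[mu]_(x in `[a, t]) g x.
have hb : h b = h a.
  apply: W11_derive0_cst => //; first by apply: W11B => //; exact: Rintegral_W11.
  have := ae_derivativeB fg (Rintegral_ae_derivative gab).
  by apply: lebesgue_aeS => t H tab; have := H tab; rewrite subrr.
move: hb; rewrite /h set_itv1 Rintegral_set1 subr0 => <-.
by rewrite opprB addrC subrK.
Qed.

Lemma W11_derive_unique a b f g h : W11 a b f -> W11 a b g ->
  ae_derivative a b f h -> ae_derivative a b g h -> f a = g a ->
  forall t, a <= t <= b -> f t = g t.
Proof.
move=> fab gab fh gh fga t /andP[at_ tb].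
have : f t - g t = f a - g a.
  apply: (W11_derive0_cst (a := a) (b := t) (f := fun t => f t - g t)) => //.
    by apply: (W11S (a := a) (b := b)) => //; exact: W11B.
  apply: (@ae_derivativeS a b) => //.
  have := ae_derivativeB fh gh.
  by apply: lebesgue_aeS => x H xab; have := H xab; rewrite subrr.
by rewrite fga subrr => /eqP; rewrite subr_eq0 => /eqP.
Qed.

(** A null set contains no nondegenerate interval, so [f] has zeros arbitrarily close to [t];
    continuity concludes. *)
Lemma W11_ae0 a b f : a < b -> W11 a b f ->
  {ae mu, forall t, `[a, b]%classic t -> f t = 0} ->
  forall t, a <= t <= b -> f t = 0.
Proof.
move=> ab fab [N [mN N0 fN]] t tab; apply/eqP; rewrite -normr_le0.
apply/ler_addgt0Pl => e e0; rewrite addr0.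
have [d d0 H] := W11_uniformly_continuous fab e0.
pose p := Num.max a (t - d / 2); pose q := Num.min b (t + d / 2).
have pq : p < q.
  rewrite /p /q lt_min !gt_max.
  by apply/andP; split; apply/andP; split; lra.
have [x xpq fx] : exists2 x, `[p, q]%classic x & f x = 0.
  apply: contrapT => H0; have : (mu `[p, q] <= mu N)%E.
    apply: le_measure; rewrite ?inE// => x xpq; apply: fN => /= fx0; apply: H0.
    exists x => //; apply: fx0; move: xpq; rewrite /= !in_itv/= ge_max le_min.
    by move=> /andP[/andP[-> _] /andP[-> _]].
  rewrite lebesgue_measure_itv/= lte_fin pq; apply/negP; rewrite -ltNge.
  by rewrite [ltLHS]N0 lte_fin subr_gt0.
move: xpq; rewrite /= in_itv/= ge_max le_min => /andP[/andP[ax tx] /andP[xb xt]].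
rewrite -[f t]subr0 -fx ltW// H// ?ax// ltr_norml; apply/andP; split; lra.
Qed.

(** * Gluing and polynomial pieces *)

Lemma W11_cst a b k : W11 a b (fun=> k).
Proof.
by apply: (lipschitz_W11 (lexx 0)) => x y _ _; rewrite subrr normr0 mul0r.
Qed.

Lemma W11_id a b : W11 a b id.
Proof. by apply: (lipschitz_W11 ler01) => x y _ _; rewrite mul1r. Qed.

(** Meant for the truncations [min t c] and [max t c]. The third hypothesis puts the interval from
    [h x] to [h y] inside the one from [x] to [y], so that disjoint families stay disjoint. *)
Lemma W11_comp a b f h : (forall x, a <= x <= b -> a <= h x <= b) ->
  (forall x y, x <= y -> h x <= h y /\ h y - h x <= y - x) ->
  (forall x y t, h x < t < h y -> x < t < y) ->
  W11 a b f -> W11 a b (f \o h).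
Proof.
move=> hab hle hsub fab e /fab[k k0 fk]; exists k => // n l r lr tI lrk.
apply: (fk n (h \o l) (h \o r)).
- move=> i; have [al li rb] := lr i; split.
  + by have /andP[] : a <= h (l i) <= b by rewrite hab// al (le_trans li).
  + by have [] := hle _ _ li.
  + by have /andP[] : a <= h (r i) <= b by rewrite hab// rb (le_trans al).
- apply/trivIsetP => i j _ _ ij.
  have /trivIsetP/(_ i j I I ij) := tI; rewrite -!subset0 => tij t.
  move=> [/=]; rewrite !in_itv/= => /hsub ti /hsub tj.
  by apply: (tij t); split; rewrite /= in_itv.
- apply: le_lt_trans lrk; apply: ler_sum => i _.
  by have [_ li _] := lr i; have [] := hle _ _ li.
Qed.

(** Splitting intervals at [c] is avoided by writing the glued function as
    [f (min t c) + g (max t c) - g c]. *)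
Lemma W11_if a b c f g : a <= c <= b -> W11 a b f -> W11 a b g -> f c = g c ->
  W11 a b (fun t => if t < c then f t else g t).
Proof.
move=> cab fab gab fgc.
have -> : (fun t => if t < c then f t else g t) =
    (fun t => f (Num.min t c) + (g (Num.max t c) - g c)).
  apply/funext => t; rewrite minEle maxEle; case: ltP => tc.
    by rewrite (ltW tc) subrr addr0.
  have [ct|_] := leP t c; last by rewrite fgc addrC subrK.
  have -> : t = c by apply/eqP; rewrite eq_le tc ct.
  by rewrite subrr addr0.
apply: W11D; last (apply: W11B; last exact: W11_cst).
  apply: (W11_comp _ _ _ fab) => [x xab|x y xy|x y t].
  - by rewrite minEle; case: ifP.
  - by rewrite !minEle; case: (leP x c); case: (leP y c) => ? ?; split; lra.
  - rewrite !minEle; case: (leP x c); case: (leP y c) => ? ? /andP[? ?];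
      by apply/andP; split; lra.
apply: (W11_comp _ _ _ gab) => [x xab|x y xy|x y t].
- by rewrite maxEle; case: ifP.
- by rewrite !maxEle; case: (leP x c); case: (leP y c) => ? ?; split; lra.
- rewrite !maxEle; case: (leP x c); case: (leP y c) => ? ? /andP[? ?];
    by apply/andP; split; lra.
Qed.

Lemma ae_derivative_if a b c f g f' g' :
  ae_derivative a b f f' -> ae_derivative a b g g' ->
  ae_derivative a b (fun t => if t < c then f t else g t)
    (fun t => if t < c then f' t else g' t).
Proof.
move=> ff' gg'.
have fg : {ae mu, forall t, `[a, b]%classic t ->
    is_derive t 1 f (f' t) /\ is_derive t 1 g (g' t)}.
  by apply: lebesgue_aeS2 ff' gg' => t ft gt tab; split; [exact: ft|exact: gt].
apply: (lebesgue_aeS2 _ (ae_notin [:: c]) fg) => t.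
rewrite !inE => tc + tab => /(_ tab)[ft gt].
have [tltc|] := ltP t c.
  apply: near_eq_is_derive ft; near=> s; case: ltP => //; rewrite leNgt => /negP[].
  by near: s; exact: lt_nbhsl.
rewrite le_eqVlt eq_sym (negPf tc)/= => ctt.
apply: near_eq_is_derive gt; near=> s; case: ltP => //; rewrite ltNge => /negP[].
by apply/ltW; near: s; exact: lt_nbhsr.
Unshelve. all: by end_near. Qed.

(** All branches of the states, the control and [phi] are polynomials of degree at most three;
    Horner's form reduces them to sums and products. *)
Lemma W11_cubic a b c k3 k2 k1 k0 f :
  (forall t, f t = k3 * (t - c) ^+ 3 + k2 * (t - c) ^+ 2 + k1 * (t - c) + k0) ->
  W11 a b f.
Proof.
move=> fE.
rewrite (_ : f = fun t =>
    ((k3 * (t - c) + k2) * (t - c) + k1) * (t - c) + k0).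
  have cst := W11_cst a b; have X := W11B (W11_id a b) (cst c).
  apply: W11D => //; apply: W11M => //; apply: W11D => //; apply: W11M => //.
  by apply: W11D => //; apply: W11M.
by apply/funext => t; rewrite fE; ring.
Qed.

Lemma ae_derivative_cubic a b c k3 k2 k1 k0 f g :
  (forall t, f t = k3 * (t - c) ^+ 3 + k2 * (t - c) ^+ 2 + k1 * (t - c) + k0) ->
  (forall t, g t = 3 * k3 * (t - c) ^+ 2 + 2 * k2 * (t - c) + k1) ->
  ae_derivative a b f g.
Proof.
move=> fE gE.
have cst k : ae_derivative a b (fun=> k) (fun=> 0).
  by apply: (ae_derivativeP (s := [::])) => t _ _; exact: is_derive_cst.
have X : ae_derivative a b (fun t => t - c) (fun=> 1 - 0).
  apply: ae_derivativeB => //.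
  by apply: (ae_derivativeP (s := [::])) => t _ _; exact: is_derive_id.
have -> : f = fun t => ((k3 * (t - c) + k2) * (t - c) + k1) * (t - c) + k0.
  by apply/funext => t; rewrite fE; ring.
have H := ae_derivativeD (ae_derivativeM (ae_derivativeD (ae_derivativeM
  (ae_derivativeD (ae_derivativeM (cst k3) X) (cst k2)) X) (cst k1)) X) (cst k0).
by apply: eq_ae_derivative H => t _ /=; rewrite gE; ring.
Qed.

(** * A sufficient condition for optimality *)

Lemma costE alpha w z : W11 0 1 w -> L1 0 1 z ->
  cost alpha w z =
  (\int[mu]_(t in `[0, 1]) (2^-1 * w t ^+ 2 + alpha * `|z t|))%:E.
Proof.
move=> w1 z1; rewrite fineK//; apply: integrable_fin_num => //.
have w2 : L1 0 1 (fun t => 2^-1 * w t ^+ 2).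
  by apply: L1Z; apply: continuous_L1; apply: W11_continuous; exact: W11M.
exact: (L1D w2 (L1Z alpha (L1_norm z1))).
Qed.

Section Verification.
Variables (s0 sf v0 vf alpha p q : R) (x1 x2 u v phi : R -> R).
Hypothesis feas : feasible s0 sf v0 vf x1 x2 u v.
Hypotheses (phi1 : W11 0 1 phi) (phiE0 : phi 0 = 0) (phiE1 : phi 1 = 0).
Hypothesis dphi : ae_derivative 0 1 phi (fun t => u t - (p + q * t)).
Hypothesis phi_le : forall t, 0 <= t <= 1 -> `|phi t| <= alpha.
Hypothesis phi_v : forall t, 0 <= t <= 1 -> phi t * v t = alpha * `|v t|.

(* The integrand is the derivative of
   [phi (w - u) + (p + q t) (y2 - x2) - q (y1 - x1)], which vanishes at both
   ends. *)
Lemma first_variation0 (y1 y2 w z : R -> R) : feasible s0 sf v0 vf y1 y2 w z ->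
  \int[mu]_(t in `[0, 1]) (u t * (w t - u t) + phi t * (z t - v t)) = 0.
Proof.
move: feas => [[x11 x21 u1 v1] [dx1 dx2 du] [x10 x11e x20 x21e]].
move=> [[y11 y21 w1 z1] [dy1 dy2 dw] [y10 y11e y20 y21e]].
have lin1 : W11 0 1 (fun t => p + q * t).
  apply: (lipschitz_W11 (normr_ge0 q)) => s t _ _.
  by rewrite opprD addrACA subrr add0r -mulrBr normrM.
have dlin : ae_derivative 0 1 (fun t => p + q * t) (fun=> q).
  apply: (ae_derivativeP (s := [::])) => t _ _.
  have := is_deriveD (is_derive_cst p t 1) (is_deriveZ q (is_derive_id t 1)).
  by rewrite add0r -[q *: 1]/(q * 1) mulr1.
have dq : ae_derivative 0 1 (fun=> q) (fun=> 0).
  by apply: (ae_derivativeP (s := [::])) => t _ _; exact: is_derive_cst.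
have q1 : W11 0 1 (fun=> q).
  by apply: (lipschitz_W11 (lexx 0)) => s t _ _; rewrite subrr normr0 mul0r.
have wu := W11B w1 u1; have zv := L1B z1 v1.
pose G t := phi t * (w t - u t) + (p + q * t) * (y2 t - x2 t) - q * (y1 t - x1 t).
rewrite (W11_FTC (f := G))//.
- by rewrite /G phiE0 phiE1 y21e x21e y11e x11e y10 x10 y20 x20; ring.
- apply: W11B; [apply: W11D|]; apply: W11M => //; exact: W11B.
- have dG := ae_derivativeB (ae_derivativeD
    (ae_derivativeM dphi (ae_derivativeB dw du))
    (ae_derivativeM dlin (ae_derivativeB dy2 dx2)))
    (ae_derivativeM dq (ae_derivativeB dy1 dx1)).
  by apply: eq_ae_derivative dG => t _ /=; ring.
- apply: L1D; last exact: L1M.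
  by apply: continuous_L1; apply: W11_continuous; exact: W11M.
Qed.

Lemma cost_gap (y1 y2 w z : R -> R) : feasible s0 sf v0 vf y1 y2 w z ->
  (cost alpha u v + (\int[mu]_(t in `[0, 1]) (2^-1 * (w t - u t) ^+ 2))%:E <=
   cost alpha w z)%E.
Proof.
move=> yfeas; have := first_variation0 yfeas.
move: feas => [[_ _ u1 v1] _ _]; move: yfeas => [[_ _ w1 z1] _ _].
have wu := W11B w1 u1; have zv := L1B z1 v1.
have sqL1 f : W11 0 1 f -> L1 0 1 (fun t => 2^-1 * f t ^+ 2).
  move=> f1; apply: L1Z; apply: continuous_L1; apply: W11_continuous.
  exact: W11M.
have costL1 f g : W11 0 1 f -> L1 0 1 g ->
    L1 0 1 (fun t => 2^-1 * f t ^+ 2 + alpha * `|g t|).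
  by move=> f1 g1; exact: (L1D (sqL1 _ f1) (L1Z alpha (L1_norm g1))).
have vL1 : L1 0 1 (fun t => u t * (w t - u t) + phi t * (z t - v t)).
  apply: L1D; last exact: L1M.
  by apply: continuous_L1; apply: W11_continuous; exact: W11M.
(* The vanishing first variation is added on the left, after which the inequality holds between the
   integrands. *)
rewrite !costE// lee_fin => v0E; rewrite -[leLHS]addr0 -[X in _ + X <= _]v0E.
have cL1 := costL1 _ _ u1 v1; have sL1 := sqL1 _ wu.
rewrite -(Rintegral_L1D cL1 sL1) -(Rintegral_L1D (L1D cL1 sL1) vL1).
apply: (le_Rintegral_L1 (L1D (L1D cL1 sL1) vL1) (costL1 _ _ w1 z1)) => t t01.
have phiz : phi t * z t <= alpha * `|z t|.
  by rewrite (le_trans (ler_norm _))// normrM ler_wpM2r// phi_le.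
have := phi_v t01; lra.
Qed.

(** For uniqueness, the gap forces [w = u] almost everywhere, hence everywhere by continuity; the
    states then agree because they share derivatives and initial values. *)
Lemma verification : is_unique_solution s0 sf v0 vf alpha x1 x2 u v.
Proof.
have sq_ge0 f : 0 <= \int[mu]_(t in `[0, 1]) (2^-1 * f t ^+ 2).
  by apply: Rintegral_ge0 => t _; rewrite mulr_ge0// sqr_ge0.
split.
  split=> // y1 y2 w z yfeas; apply: le_trans (cost_gap yfeas).
  by rewrite leeDl// lee_fin.
move=> y1 y2 w z [yfeas ymin].
have := le_trans (cost_gap yfeas) (ymin _ _ _ _ feas).
move: feas => [[x11 x21 u1 v1] [dx1 dx2 du] [x10 _ x20 _]].
move: yfeas => [[y11 y21 w1 z1] [dy1 dy2 dw] [y10 _ y20 _]].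
have wu1 := W11B w1 u1.
rewrite costE// lee_fin gerDl => le0.
have wu_sq : L1 0 1 (fun t => 2^-1 * (w t - u t) ^+ 2).
  by apply: L1Z; apply: continuous_L1; apply: W11_continuous; exact: W11M.
have wu t : 0 <= t <= 1 -> w t = u t.
  move=> t01; apply/eqP; rewrite -subr_eq0; apply/eqP.
  apply: (W11_ae0 ltr01 wu1) => //.
  apply: lebesgue_aeS (Rintegral_le0_ae wu_sq _ le0) => [s + s01|s].
    by move=> /(_ s01) /eqP; rewrite mulf_eq0 invr_eq0 pnatr_eq0/= sqrf_eq0 => /eqP.
  by rewrite mulr_ge0// sqr_ge0.
have y2E : forall t, 0 <= t <= 1 -> y2 t = x2 t.
  apply: (W11_derive_unique y21 x21 dy2); last by rewrite y20.
  by apply: eq_ae_derivative dx2 => t /wu.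
have y1E : forall t, 0 <= t <= 1 -> y1 t = x1 t.
  apply: (W11_derive_unique y11 x11 dy1); last by rewrite y10.
  by apply: eq_ae_derivative dx1 => t /y2E.
split=> [t t01|]; first by rewrite y1E// y2E// wu.
have dwu : {ae mu, forall t, `[0, 1]%classic t ->
    is_derive t 1 w (z t) /\ is_derive t 1 u (v t)}.
  by apply: lebesgue_aeS2 dw du => t dwt dut t01; split; [exact: dwt|exact: dut].
(* Derivatives are two-sided while [w] and [u] agree only on [[0, 1]], so the endpoints are
   discarded. *)
apply: (lebesgue_aeS2 _ (ae_notin [:: 0; 1]) dwu) => t.
rewrite !inE negb_or => /andP[t0 t1] H t01.
have [dwt dut] := H t01; move: t01; rewrite set_itvcc => /andP[t_ge0 t_le1].
have t_gt0 : 0 < t by rewrite lt_neqAle eq_sym t0.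
have t_lt1 : t < 1 by rewrite lt_neqAle t1.
have : is_derive t 1 u (z t).
  apply: near_eq_is_derive dwt; near=> s; apply: wu; apply/andP; split.
    by apply/ltW; near: s; exact: lt_nbhsr.
  by apply/ltW; near: s; exact: lt_nbhsl.
by move=> [_ <-]; move: dut => [_ <-].
Unshelve. all: by end_near. Qed.

End Verification.

(** * The extremal *)

(** Used for the optimal control, a constant plus [lambda] times a nondecreasing ramp, where
    [lambda] may have either sign. *)
Lemma total_variation_affine a b k c g : a <= b ->
  {in `[a, b] &, nondecreasing_fun g} ->
  total_variation a b (fun t => c + k * g t) = `|k * (g b - g a)|%:E.
Proof.
move=> ab gnd.
have gab : 0 <= g b - g a by rewrite subr_ge0 gnd// in_itv/= lexx ?ab.
have H m d : 0 <= m ->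
    total_variation a b (fun t => d + m * g t) = (m * (g b - g a))%:E.
  move=> m0; rewrite nondecreasing_total_variation//.
    by congr (_%:E); ring.
  by move=> x y xab yab xy; rewrite lerD2l ler_wpM2l// gnd.
have [k0|/ltW k0] := leP 0 k; first by rewrite H// ger0_norm// mulr_ge0.
rewrite -total_variationN.
have -> : \- (fun t => c + k * g t) = (fun t => - c + - k * g t).
  by apply/funext => t /=; ring.
by rewrite H ?oppr_ge0// mulNr ler0_norm// mulr_le0_ge0.
Qed.

(** The cubic is strictly decreasing on the interval, equals 1 at 0 and [- (3 / 4 * c)] at 1/2. The
    root is therefore 1/2 only for [c = 0]. *)
Lemma cubic_root c : 0 <= c -> exists t : R,
  [/\ 0 < t <= 2^-1, 4 * t ^+ 3 - 3 * (2 + c) * t ^+ 2 + 1 = 0,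
      (forall s, 0 < s <= 2^-1 ->
        4 * s ^+ 3 - 3 * (2 + c) * s ^+ 2 + 1 = 0 -> s = t)
    & (c != 0 -> t < 2^-1)].
Proof.
move=> c0; pose f t : R := 4 * t ^+ 3 - 3 * (2 + c) * t ^+ 2 + 1.
have mono s t : 0 < s -> s < t -> t <= 2^-1 -> f t < f s.
  move=> s0 st t2; rewrite -subr_gt0.
  have -> : f s - f t =
      (t - s) * (3 * (2 + c) * (t + s) - 4 * (t ^+ 2 + t * s + s ^+ 2)).
    by rewrite /f; ring.
  (* Since [t + s < 1], one has [4 * (t ^+ 2 + t * s + s ^+ 2) < 6 * (t + s)]. *)
  rewrite mulr_gt0 ?subr_gt0//.
  have : 0 <= c * (t + s) by rewrite mulr_ge0//; lra.
  nra.
have uniq s t : 0 < s <= 2^-1 -> 0 < t <= 2^-1 -> f s = 0 -> f t = 0 -> s = t.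
  move=> /andP[s0 s2] /andP[t0 t2] fs ft; apply/eqP; rewrite eq_le !leNgt.
  apply/andP; split; apply/negP => st.
    by have := mono _ _ t0 st s2; rewrite fs ft ltxx.
  by have := mono _ _ s0 st t2; rewrite fs ft ltxx.
have fc : {within `[0, 2^-1], continuous f}.
  apply: W11_continuous.
  apply: (@W11_cubic _ _ 0 4 (- (3 * (2 + c))) 0 1) => t; rewrite /f; ring.
have f0 : f 0 = 1 by rewrite /f; ring.
have f2 : f 2^-1 = - (3 / 4 * c) by rewrite /f; field.
have half0 : 0 <= 2^-1 :> R by lra.
have between : Num.min (f 0) (f 2^-1) <= 0 <= Num.max (f 0) (f 2^-1).
  by rewrite f0 f2 minEle maxEle; case: ifP; lra.
have [t] := IVT half0 fc between.
rewrite in_itv/= => /andP[t0 t2] ft.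
have {}t0 : 0 < t.
  rewrite lt_neqAle t0 andbT; apply/eqP => t0E.
  by move: ft; rewrite -t0E f0 => /eqP; rewrite oner_eq0.
exists t; split => //; first by rewrite t0.
  by move=> s s2 fs; apply: uniq; rewrite ?t0.
move=> cn0; rewrite lt_neqAle t2 andbT; apply/eqP => t2E.
by move: ft; rewrite t2E f2 => ?; move/eqP: cn0; apply; lra.
Qed.

Lemma L1_step a b c d k :
  L1 a b (fun t => if t < c then 0 else if t < d then k else 0).
Proof.
have -> : (fun t => if t < c then 0 else if t < d then k else 0) =
    (fun t => k * \1_(`[c, d[%classic) t).
  apply/funext => t; rewrite indicE; case: (ltP t c) => tc.
    by rewrite memNset ?mulr0//= in_itv/= leNgt tc.
  case: (ltP t d) => td; first by rewrite mem_set ?mulr1//= in_itv/= tc.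
  by rewrite memNset ?mulr0//= in_itv/= ltNge td andbF.
apply: L1Z; apply: integrableS (integrable_indic_itv c d true true) => //.
Qed.

Section Extremal.
Variables (s0 sf v0 vf alpha t1 lambda : R).
Hypothesis t1_bnd : 0 < t1 <= 2^-1.
Let t2 := 1 - t1.
(** These values give [u3 - u1 = lambda * (t2 - t1)], which is continuity of the control, and
    [(u1 + u3) / 2 = vf - v0]; by symmetry about 1/2 this mean is the integral of the control, so
    that x2(1) = vf. *)
Let u1 := vf - v0 - lambda / 2 * (1 - 2 * t1).
Let u3 := 2 * (vf - v0) - u1.
(** With these [u1] and [u3], this is the end condition x1(1) = sf. *)
Hypothesis lambda_D :
  vf + v0 + 2 * (s0 - sf) = lambda * (4 * t1 ^+ 3 - 6 * t1 ^+ 2 + 1) / 6.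

Let v t := if t < t1 then 0 else if t < t2 then lambda else 0.
Let x1 := opt_x1 s0 v0 t1 t2 lambda u1 u3.
Let x2 := opt_x2 v0 t1 t2 lambda u1 u3.
Let u := opt_u t1 t2 lambda u1 u3.

Let t1_01 : 0 <= t1 <= 1.
Proof. by move: t1_bnd => /andP[? ?]; apply/andP; split; lra. Qed.

Let t2_01 : 0 <= t2 <= 1.
Proof. by move: t1_bnd => /andP[? ?]; rewrite /t2; apply/andP; split; lra. Qed.

(** Continuity at [t1]: for [t1 = 1/2] the middle piece is empty and the first branch meets the last
    one directly. *)
Let glue (y2 y3 y : R) : y2 = y -> (t2 = t1 -> y3 = y) ->
  y = if t1 < t2 then y2 else y3.
Proof.
move=> y2E y3E; case: ltP => // t21; rewrite y3E//.
by move: t1_bnd t21 => /andP[? ?]; rewrite /t2 => ?; lra.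
Qed.

Lemma extremal_feasible : feasible s0 sf v0 vf x1 x2 u v.
Proof.
have [t10 t12] := andP t1_bnd.
have e1 : (1 < t1) = false by apply/negbTE; rewrite -leNgt; lra.
have e2 : (1 < t2) = false by apply/negbTE; rewrite -leNgt /t2; lra.
split; split.
- apply: W11_if => //; [|apply: W11_if => // |].
  + by apply: (@W11_cubic _ _ 0 0 (2^-1 * u1) v0 s0) => t; ring.
  + by apply: (@W11_cubic _ _ t1 (6^-1 * lambda) (2^-1 * u1) (v0 + u1 * t1)
      (2^-1 * u1 * t1 ^+ 2 + v0 * t1 + s0)) => t; field.
  + by apply: (@W11_cubic _ _ t2 0 (2^-1 * u3)
      (2^-1 * lambda * (t2 - t1) ^+ 2 + u1 * t2 + v0)
      (6^-1 * lambda * (t2 - t1) ^+ 3 + 2^-1 * u1 * t2 ^+ 2 + v0 * t2 + s0)) => t;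
    ring.
  + by ring.
  + by apply: glue => [|->]; ring.
- apply: W11_if => //; [|apply: W11_if => // |].
  + by apply: (@W11_cubic _ _ 0 0 0 u1 v0) => t; ring.
  + by apply: (@W11_cubic _ _ t1 0 (2^-1 * lambda) u1 (u1 * t1 + v0)) => t; ring.
  + by apply: (@W11_cubic _ _ t2 0 0 u3
      (2^-1 * lambda * (t2 - t1) ^+ 2 + u1 * t2 + v0)) => t; ring.
  + by ring.
  + by apply: glue => [|->]; ring.
- apply: W11_if => //; [|apply: W11_if => // |].
  + exact: W11_cst.
  + by apply: (@W11_cubic _ _ t1 0 0 lambda u1) => t; ring.
  + exact: W11_cst.
  + by rewrite /u3 /u1 /t2; field.
  + apply: glue => [|t21]; first by ring.
    have -> : u3 = u1 + lambda * (t2 - t1) by rewrite /u3 /u1 /t2; field.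
    by rewrite t21; ring.
- exact: L1_step.
- apply: ae_derivative_if; [|apply: ae_derivative_if].
  + by apply: (@ae_derivative_cubic _ _ 0 0 (2^-1 * u1) v0 s0) => t; field.
  + by apply: (@ae_derivative_cubic _ _ t1 (6^-1 * lambda) (2^-1 * u1)
      (v0 + u1 * t1) (2^-1 * u1 * t1 ^+ 2 + v0 * t1 + s0)) => t; field.
  + by apply: (@ae_derivative_cubic _ _ t2 0 (2^-1 * u3)
      (2^-1 * lambda * (t2 - t1) ^+ 2 + u1 * t2 + v0)
      (6^-1 * lambda * (t2 - t1) ^+ 3 + 2^-1 * u1 * t2 ^+ 2 + v0 * t2 + s0)) => t;
    field.
- apply: ae_derivative_if; [|apply: ae_derivative_if].
  + by apply: (@ae_derivative_cubic _ _ 0 0 0 u1 v0) => t; ring.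
  + by apply: (@ae_derivative_cubic _ _ t1 0 (2^-1 * lambda) u1
      (u1 * t1 + v0)) => t; field.
  + by apply: (@ae_derivative_cubic _ _ t2 0 0 u3
      (2^-1 * lambda * (t2 - t1) ^+ 2 + u1 * t2 + v0)) => t; ring.
- apply: ae_derivative_if; [|apply: ae_derivative_if].
  + by apply: (@ae_derivative_cubic _ _ 0 0 0 0 u1) => t; ring.
  + by apply: (@ae_derivative_cubic _ _ t1 0 0 lambda u1) => t; ring.
  + by apply: (@ae_derivative_cubic _ _ 0 0 0 0 u3) => t; ring.
- by rewrite /x1 /opt_x1 t10; ring.
- rewrite /x1 /opt_x1 e1 e2.
  have -> : sf = s0 + (vf + v0 - (vf + v0 + 2 * (s0 - sf))) / 2 by field.
  by rewrite lambda_D /u3 /u1 /t2; field.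
- by rewrite /x2 /opt_x2 t10; ring.
- by rewrite /x2 /opt_x2 e1 e2 /u3 /u1 /t2; field.
Qed.

(** The plateau of [phi] has height [lambda / 2 * t1 ^+ 2]. The two hypotheses say that it is at
    most [alpha] in absolute value and that [phi * v = alpha * |v|] there; in this form they also
    cover [lambda = 0]. *)
Hypothesis lambda_le : `|lambda| * t1 ^+ 2 <= 2 * alpha.
Hypothesis lambda_eq : lambda * (lambda * t1 ^+ 2) = 2 * alpha * `|lambda|.

Lemma extremal_unique_solution :
  is_unique_solution s0 sf v0 vf alpha x1 x2 u v.
Proof.
have [t10 t12] := andP t1_bnd.
pose phi t := if t < t1 then lambda / 2 * (t1 ^+ 2 - (t - t1) ^+ 2)
  else if t < t2 then lambda / 2 * t1 ^+ 2
  else lambda / 2 * (t1 ^+ 2 - (t - t2) ^+ 2).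
have e1 : (1 < t1) = false by apply/negbTE; rewrite -leNgt; lra.
have e2 : (1 < t2) = false by apply/negbTE; rewrite -leNgt /t2; lra.
(* The affine function [p + q * t] extends the middle branch of [u], so [phi] has derivative 0 on
   that branch. *)
apply: (@verification _ _ _ _ _ (vf - v0 - lambda / 2) lambda _ _ _ _ phi).
- exact: extremal_feasible.
- apply: W11_if => //; [|apply: W11_if => // |].
  + apply: (@W11_cubic _ _ t1 0 (- (lambda / 2)) 0 (lambda / 2 * t1 ^+ 2)) => t.
    by ring.
  + exact: W11_cst.
  + apply: (@W11_cubic _ _ t2 0 (- (lambda / 2)) 0 (lambda / 2 * t1 ^+ 2)) => t.
    by ring.
  + by ring.
  + by apply: glue => [|->]; ring.
- by rewrite /phi t10; ring.
- by rewrite /phi e1 e2 /t2; ring.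
- have dphi : ae_derivative 0 1 phi (fun t => if t < t1 then lambda * (t1 - t)
      else if t < t2 then 0 else lambda * (t2 - t)).
    apply: ae_derivative_if; [|apply: ae_derivative_if].
    + by apply: (@ae_derivative_cubic _ _ t1 0 (- (lambda / 2)) 0
        (lambda / 2 * t1 ^+ 2)) => t; field.
    + by apply: (@ae_derivative_cubic _ _ 0 0 0 0 (lambda / 2 * t1 ^+ 2)) => t;
        ring.
    + by apply: (@ae_derivative_cubic _ _ t2 0 (- (lambda / 2)) 0
        (lambda / 2 * t1 ^+ 2)) => t; field.
  apply: eq_ae_derivative dphi => t _; rewrite /u /opt_u /u3 /u1 /t2.
  by case: ifP => _; [field|case: ifP => _; field].
(* Here [s] is the distance to the vertex of a parabola, at most [t1] on both outer pieces; [s = 0]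
   gives the plateau. *)
- have small s : s ^+ 2 <= t1 ^+ 2 ->
      `|lambda / 2 * (t1 ^+ 2 - s ^+ 2)| <= alpha.
    move=> st; rewrite !normrM (ger0_norm (_ : 0 <= 2^-1)) ?invr_ge0//.
    rewrite (ger0_norm (_ : 0 <= t1 ^+ 2 - s ^+ 2)) ?subr_ge0//.
    rewrite mulrAC ler_pdivrMr// (mulrC alpha) (le_trans _ lambda_le)//.
    by rewrite ler_wpM2l// gerBl sqr_ge0.
  move=> t /andP[t0 t_1]; rewrite /phi; case: (ltP t t1) => tt1.
    by apply: small; nra.
  case: (ltP t t2) => tt2.
    have := small 0; rewrite expr0n subr0; apply; exact: sqr_ge0.
  by apply: small; move: tt2; rewrite /t2; nra.
- move=> t _; rewrite /phi /v; case: ltP => _; first by rewrite normr0 !mulr0.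
  case: ltP => _; last by rewrite normr0 !mulr0.
  by move: lambda_eq; lra.
Qed.

Lemma extremal_total_variation :
  total_variation 0 1 u = `|lambda * (1 - 2 * t1)|%:E.
Proof.
have [t10 t12] := andP t1_bnd.
pose g t := if t < t1 then 0 else if t < t2 then t - t1 else t2 - t1.
have -> : u = (fun t => u1 + lambda * g t).
  apply/funext => t; rewrite /u /opt_u /g /u3 /u1 /t2.
  by case: ifP => _; [ring|case: ifP => _; field].
have g0 : g 0 = 0 by rewrite /g t10.
have g1 : g 1 = t2 - t1.
  have e1 : (1 < t1) = false by apply/negbTE; rewrite -leNgt; lra.
  have e2 : (1 < t2) = false by apply/negbTE; rewrite -leNgt /t2; lra.
  by rewrite /g e1 e2.
rewrite total_variation_affine//.
  by rewrite g0 g1 subr0; congr (`|_ * _|%:E); rewrite /t2; ring.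
move=> x y _ _ xy; rewrite /g.
case: (ltP x t1) => xt1; case: (ltP y t1) => yt1; case: (ltP x t2) => xt2;
  case: (ltP y t2) => yt2; move: xt1 yt1 xt2 yt2; rewrite /t2 => *; lra.
Qed.

End Extremal.

End DoubleIntegrator.

(** The endpoint 1/2 is the root exactly when D = 0; then lambda1 = 0 and the control is constant.
    The total variation is [|u3 - u1|], the control being monotone. *)
Theorem theorem1 (R : realType) (s0 sf v0 vf alpha : R) (halpha : 0 < alpha) :
  let D := vf + v0 + 2 * (s0 - sf) in
  let cbar := `|vf + v0 + 2 * (s0 - sf)| / alpha in
  let cubic := fun t : R => 4 * t ^+ 3 - 3 * (2 + cbar) * t ^+ 2 + 1 in
  exists t1 : R,
    [/\ 0 < t1 <= 2^-1, cubic t1 = 0,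
        (forall t : R, 0 < t <= 2^-1 -> cubic t = 0 -> t = t1),
        (D != 0 -> t1 < 2^-1)
      & let t2 := 1 - t1 in
        let lambda1 := Num.sg D * (2 * alpha / t1 ^+ 2) in
        let u1 := vf - v0 - lambda1 / 2 * (1 - 2 * t1) in
        let u3 := 2 * (vf - v0) - u1 in
        let u := opt_u t1 t2 lambda1 u1 u3 in
        (exists v : R -> R,
           is_unique_solution s0 sf v0 vf alpha
             (opt_x1 s0 v0 t1 t2 lambda1 u1 u3)
             (opt_x2 v0 t1 t2 lambda1 u1 u3) u v) /\
        total_variation 0 1 u =
          `|Num.sg D * (2 * alpha / t1 ^+ 2) * (1 - 2 * t1)|%:E].
Proof.
move=> D cbar cubic.
have cbar_ge0 : 0 <= cbar by rewrite divr_ge0// ltW.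
have [t1 [t1b t1E t1U t1lt]] := cubic_root cbar_ge0.
exists t1; split => //.
  move=> D0; apply: t1lt.
  by rewrite mulf_eq0 normr_eq0 (negPf D0) invr_eq0 gt_eqF.
have [t10 _] := andP t1b.
move=> t2 lambda1; have t1n0 : t1 != 0 by rewrite gt_eqF.
have lambda_sq : lambda1 * t1 ^+ 2 = 2 * alpha * Num.sg D.
  by rewrite /lambda1; field.
(* The cubic equation turns the bracket into [3 * cbar * t1 ^+ 2]; with [lambda_sq] and
   [cbar * alpha = |D|] the right side becomes [sg D * |D|]. *)
have lambdaD : D = lambda1 * (4 * t1 ^+ 3 - 6 * t1 ^+ 2 + 1) / 6.
  have -> : 4 * t1 ^+ 3 - 6 * t1 ^+ 2 + 1 = 3 * cbar * t1 ^+ 2.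
    by move: t1E; lra.
  rewrite [in LHS](numEsg D) /cbar -/D /lambda1; field.
  by rewrite t1n0 gt_eqF.
have norm_lambda : `|lambda1| * t1 ^+ 2 = 2 * alpha * `|Num.sg D|.
  rewrite -[t1 ^+ 2]ger0_norm ?sqr_ge0// -normrM lambda_sq normrM.
  by rewrite [`|2 * alpha|]ger0_norm// mulr_ge0// ltW.
split; last exact: extremal_total_variation.
eexists; apply: extremal_unique_solution => //.
  rewrite norm_lambda ler_piMr ?mulr_ge0 ?(ltW halpha)// normr_sg.
  by case: (D != 0).
have scale_gt0 : 0 < 2 * alpha / t1 ^+ 2.
  by rewrite divr_gt0 ?exprn_gt0 ?mulr_gt0.
have -> : `|lambda1| = Num.sg D * lambda1.
  by rewrite normrEsg /lambda1 sgrM sgr_id (gtr0_sg scale_gt0) mulr1.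
by rewrite lambda_sq; ring.
Qed.
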